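(* Let $(X,d)$ be a compact metric space and $\varphi:X\to X$ a continuous map. Let $\mathrm C^+$ stand for any one of the three indices $\mathrm C$, $\mathrm C^*$, $\underline{\mathrm C}$. Then: (1) (Invariance) $\mathrm C^+$ is a $C^0$ conjugacy invariant and does not depend on the choice of topologically equivalent metrics on $X$. (2) (Factors) If $(X',d')$ is another compact metric space and $\psi:X'\to X'$ is a (continuous) factor of $\varphi$, that is, if there exists a continuous surjective map $h:X\to X'$ with $\psi\circ h=h\circ\varphi$, then $\mathrm C^+(\varphi)\ge \mathrm C^+(\psi)$. (3) (Restriction) If $Y\subset X$ is invariant under $\varphi$ and endowed with the induced metric $\hat d$, then $\mathrm C^+_{d}(\varphi,Y)=\mathrm C^+_{\hat d}(\varphi_{|Y})$ (the subscript indicating the metric used). (4) (Monotonicity) If $Y\subset Y'$ are subsets of $X$, then $\mathrm C^+(\varphi,Y)\le \mathrm C^+(\varphi,Y')$. (5) (Transport) For any $Y\subset X$, $\mathrm C^+(\varphi,\varphi(Y))\le \mathrm C^+(\varphi,Y)$. As a consequence, if $\varphi$ is a homeomorphism, then $\mathrm C^+(\varphi,\varphi(Y))=\mathrm C^+(\varphi,Y)$.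
   Context: Let $(X,d)$ be a compact metric space, $\varphi:X\to X$ continuous. For $n\ge1$, $d_n^\varphi(x,y)=\max_{0\le k\le n-1}d(\varphi^k(x),\varphi^k(y))$ and $B_n(x,\varepsilon)$ is the open $d_n^\varphi$-ball. For any subset $Y\subset X$ (not necessarily invariant), $G_n(Y,\varepsilon)$ is the minimal number of balls $B_n(x,\varepsilon)$, $x\in X$, covering $Y$. Complexity index: $\mathrm C(\varphi,Y)=\lim_{\varepsilon\to0}\inf\{\sigma\ge0:\lim_{n\to\infty}n^{-\sigma}G_n(Y,\varepsilon)=0\}$. Lower complexity index: $\underline{\mathrm C}(\varphi,Y)=\lim_{\varepsilon\to0}\sup\{\sigma\ge0:\lim_{n\to\infty}n^{-\sigma}G_n(Y,\varepsilon)=+\infty\}$ (with $\sup\emptyset=0$). Weak complexity index: for $N\ge1$ let $\mathcal C_{\ge N}(Y,\varepsilon)$ be the set of families $C=(B_{n_i}(x_i,\varepsilon))_{i\in I}$ with $x_i\in X$, $n_i\ge N$, covering $Y$; for $s\ge0$ put $M(C,s)=\sum_{i}n_i^{-s}$ and $\Delta(Y,\varepsilon,s)=\lim_{N\to\infty}\inf\{M(C,s):C\in\mathcal C_{\ge N}(Y,\varepsilon)\}$. There is a unique $s_c(Y,\varepsilon)\in[0,+\infty]$ with $\Delta(Y,\varepsilon,s)=0$ for $s>s_c(Y,\varepsilon)$ and $=+\infty$ for $s<s_c(Y,\varepsilon)$; $\mathrm C^*(\varphi,Y)=\lim_{\varepsilon\to0}s_c(Y,\varepsilon)$. One writes $\mathrm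 C^+(\varphi)=\mathrm C^+(\varphi,X)$. In (3), the indices of $\varphi_{|Y}$ on $(Y,\hat d)$ are defined by the same formulas with $Y$ as ambient space. *)

(* Defs.v *)
From HB Require Import structures.
From mathcomp Require Import all_boot all_order all_algebra.
From mathcomp Require Import all_classical all_reals all_analysis.

Set Implicit Arguments.
Unset Strict Implicit.
Unset Printing Implicit Defensive.

Import Order.TTheory GRing.Theory Num.Theory.
Import numFieldNormedType.Exports.

Local Open Scope classical_set_scope.
Local Open Scope ring_scope.

Record is_metric (R : realType) (X : Type) (d : X -> X -> R) : Prop := IsMetric {
  is_metricxx : forall x, d x x = 0;
  is_metric_eq0 : forall x y, d x y = 0 -> x = y;
  is_metric_sym : forall x y, d x y = d y x;
  is_metric_triangle : forall x y z, d x z <= d x y + d y z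
}.

Definition metric_open (R : realType) (X : Type) (d : X -> X -> R)
    (A : set X) : Prop :=
  forall x, A x -> exists2 e : R, 0 < e & [set y | d x y < e] `<=` A.

Definition topologically_equivalent (R : realType) (X : Type)
    (d d' : X -> X -> R) : Prop :=
  forall A : set X, metric_open d A <-> metric_open d' A.

Definition homeomorphism (X X' : topologicalType) (h : X -> X') : Prop :=
  continuous h /\
  exists g : X' -> X, [/\ continuous g, cancel h g & cancel g h].

(* The indices are defined for an arbitrary distance function on a bare type,
   so that one carrier can bear several metrics and a subset can be taken as
   an ambient space with the induced distance. *)
Section complexity_indices.
Context (R : realType) (X : Type) (d : X -> X -> R) (phi : X -> X).
Implicit Types (n N : nat) (e s : R) (x y : X) (Y : set X).

(* The neutral element 0 is harmless for n >= 1 since distances are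
   nonnegative. *)
Definition dyn_dist n x y : R :=
  \big[Num.max/0]_(k < n) d (iter k phi x) (iter k phi y).

Definition dyn_ball n x e : set X := [set y | dyn_dist n x y < e].

(* The value is +oo if no finite family of balls covers Y. *)
Definition cover_number Y e n : \bar R :=
  ereal_inf [set m%:R%:E | m in
    [set m : nat | exists c : 'I_m -> X,
                     Y `<=` \bigcup_(i in [set: 'I_m]) dyn_ball n (c i) e]].

Definition scaled_cover_number Y e s n : \bar R :=
  ((n%:R `^ (- s))%:E * cover_number Y e n)%E.

Definition upper_index_at Y e : \bar R :=
  ereal_inf [set s%:E | s in
    [set s : R | 0 <= s /\ scaled_cover_number Y e s @ \oo --> 0%E]].

Definition complexity_index Y : \bar R :=
  lim (upper_index_at Y e @[e --> 0^'+]).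

(* The maximum with 0 encodes the convention sup set0 = 0. *)
Definition lower_index_at Y e : \bar R :=
  maxe 0%E (ereal_sup [set s%:E | s in
    [set s : R | 0 <= s /\ scaled_cover_number Y e s @ \oo --> +oo%E]]).

Definition lower_complexity_index Y : \bar R :=
  lim (lower_index_at Y e @[e --> 0^'+]).

Definition is_cover_family N Y e (I : Type) (n : I -> nat) (x : I -> X) : Prop :=
  (forall i, (N <= n i)%N) /\ Y `<=` \bigcup_(i in [set: I]) dyn_ball (n i) (x i) e.

Definition family_mass (I : choiceType) (n : I -> nat) s : \bar R :=
  (\esum_(i in [set: I]) ((n i)%:R `^ (- s))%:E)%E.

Definition min_mass N Y e s : \bar R :=
  ereal_inf [set m | exists (I : choiceType) (n : I -> nat) (x : I -> X),
                       is_cover_family N Y e n x /\ m = family_mass n s].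

Definition weak_Delta Y e s : \bar R := lim (min_mass N Y e s @[N --> \oo]).

Definition is_critical_exponent Y e (sc : \bar R) : Prop :=
  (0 <= sc)%E /\
  forall s, 0 <= s ->
    ((sc < s%:E)%E -> weak_Delta Y e s = 0%E) /\
    ((s%:E < sc)%E -> weak_Delta Y e s = +oo%E).

(* There is exactly one critical exponent, so the default value of xget is
   never used. *)
Definition critical_exponent Y e : \bar R :=
  xget 0%E (is_critical_exponent Y e).

Definition weak_complexity_index Y : \bar R :=
  lim (critical_exponent Y e @[e --> 0^'+]).

End complexity_indices.

Inductive index_kind := Upper | Weak | Lower.

Definition Cplus (k : index_kind) (R : realType) (X : Type) (d : X -> X -> R)
    (phi : X -> X) (Y : set X) : \bar R :=
  match k with
  | Upper => complexity_index d phi Y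
  | Weak => weak_complexity_index d phi Y
  | Lower => lower_complexity_index d phi Y
  end.

Definition induced_dist (R : realType) (X : Type) (d : X -> X -> R)
    (Y : set X) : Y -> Y -> R := fun y z => d (set_val y) (set_val z).

Definition restr_map (X : Type) (phi : X -> X) (Y : set X)
    (invY : phi @` Y `<=` Y) : Y -> Y :=
  fun y => SigSub (mem_set (invY _ (imageP phi (set_mem (valP y))))).

(* Main.v *)
(* At each fixed radius, an index is monotone in the families of dynamical balls
   that cover the set: if every cover of Y by balls B_n(x, r) turns into a cover
   of Y' by balls B'_n(x', e) with the same times n, then the index of Y' at
   radius e is at most that of Y at radius r. Each index is the supremum over
   e > 0 of its values at radius e, so it suffices to find such an r for each e.
   A uniformly continuous semiconjugacy h provides it by mapping balls into
   balls. Hence the factor and transport inequalities (phi is a semiconjugacy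
   from itself to itself), invariance (by the Heine-Cantor theorem, also for the
   identity between two equivalent metrics), monotonicity, and one half of the
   restriction property; the other half moves the centers into Y. *)
Require Import Defs.
From HB Require Import structures.
From mathcomp Require Import all_boot all_order all_algebra.
From mathcomp Require Import all_classical all_reals all_analysis.

Set Implicit Arguments.
Unset Strict Implicit.
Unset Printing Implicit Defensive.

Import Order.TTheory GRing.Theory Num.Theory.
Import numFieldNormedType.Exports.

Local Open Scope classical_set_scope.
Local Open Scope ring_scope.

(** * Dynamical balls and transfer of covers *)

Lemma dyn_ballP (R : realType) (X : Type) (d : X -> X -> R) (phi : X -> X)
    n x e y : 0 < e ->
  dyn_ball d phi n x e y <->
  forall k, (k < n)%N -> d (iter k phi x) (iter k phi y) < e.
Proof.
move=> e0; rewrite /dyn_ball /dyn_dist /=; split.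
  by move=> /bigmax_ltP[_ H] k kn; exact: (H (Ordinal kn)).
by move=> H; apply/bigmax_ltP; split=> // k _; exact: H.
Qed.

Section cover_transfer.
Context {R : realType} {X X' : Type}.
Variables (d : X -> X -> R) (phi : X -> X) (d' : X' -> X' -> R).
Variables (psi : X' -> X') (Y : set X) (Y' : set X').

(* T is a relation, rather than a map X -> X', so as to cover both
   semiconjugacies X -> X' and inclusions X' -> X; the condition on Y' allows
   X' to be empty. *)
Definition cover_transfer (r e : R) : Prop :=
  exists2 T : X -> set X', Y' `<=` \bigcup_(y in Y) T y &
    Y' !=set0 -> forall n x, exists x', forall y,
      dyn_ball d phi n x r y -> T y `<=` dyn_ball d' psi n x' e.

Lemma cover_family_transfer r e : cover_transfer r e -> Y' !=set0 ->
  forall N (I : Type) (n : I -> nat) (x : I -> X),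
    is_cover_family d phi N Y r n x ->
    exists x' : I -> X', is_cover_family d' psi N Y' e n x'.
Proof.
move=> [T Y'T] /[apply] /(_ _)/choice H N I n x [Nn Yx].
have {}H : forall i : I, exists x', forall y,
    dyn_ball d phi (n i) (x i) r y -> T y `<=` dyn_ball d' psi (n i) x' e.
  by move=> i; have [f fE] := H (n i); exists (f (x i)); exact: fE.
have [x' x'E] := choice H; exists x'; split => // y' /Y'T[y Yy Ty].
by have [i _ yi] := Yx _ Yy; exists i => //; exact: x'E Ty.
Qed.

Lemma cover_number_transfer r e n : cover_transfer r e ->
  (cover_number d' psi Y' e n <= cover_number d phi Y r n)%E.
Proof.
move=> H; apply: le_ereal_inf_tmp => _ [m [c cY] <-].
have [Y'0|/set0P Y'0] := eqVneq Y' set0.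
  (* [X'] may have no point to serve as a center, but the empty set is covered by zero balls. *)
  apply: ge_ereal_inf; exists 0%:E; last by rewrite lee_fin.
  exists 0%N => //=; rewrite Y'0.
  by exists (fun i : 'I_0 => match notF (ltn_ord i) with end).
apply: ereal_inf_lbound; exists m => //=.
have [|x' [_ x'Y]] := cover_family_transfer H Y'0 (N:=0) (n:=fun=> n) (x:=c).
  by split.
by exists x'.
Qed.

Lemma min_mass_transfer r e N s : cover_transfer r e ->
  (min_mass d' psi N Y' e s <= min_mass d phi N Y r s)%E.
Proof.
move=> H; apply: le_ereal_inf_tmp => _ [I [n [x [nx ->]]]].
have [Y'0|/set0P Y'0] := eqVneq Y' set0.
  apply: (@le_trans _ _ 0%E); last first.
    by apply: esum_ge0 => i _; rewrite lee_fin powR_ge0.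
  apply: ereal_inf_lbound; rewrite Y'0.
  exists void, (fun=> 0%N), (of_void X').
  split; first by split => // -[].
  rewrite /family_mass (_ : setT = set0) ?esum_set0 //.
  by apply/seteqP; split => -[].
have [x' nx'] := cover_family_transfer H Y'0 nx.
by apply: ereal_inf_lbound; exists I, n, x'.
Qed.

End cover_transfer.

(** * Existence of the critical exponent of the weak index *)

Section weak.
Context {R : realType} {X : Type} (d : X -> X -> R) (phi : X -> X).
Implicit Types (Y : set X) (e s t : R).

Lemma min_mass_ge0 N Y e s : (0 <= min_mass d phi N Y e s)%E.
Proof.
apply: le_ereal_inf_tmp => _ [I [n [x [_ ->]]]].
by apply: esum_ge0 => i _; rewrite lee_fin powR_ge0.
Qed.

Lemma nondecreasing_min_mass Y e s :
  nondecreasing_seq (fun N => min_mass d phi N Y e s).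
Proof.
move=> N M NM; apply: ereal_inf_le_tmp => _ [I [n [x [[Mn xY] ->]]]].
by exists I, n, x; split=> //; split=> // i; exact: leq_trans (Mn i).
Qed.

Lemma weak_DeltaE Y e s :
  weak_Delta d phi Y e s = ereal_sup (range (fun N => min_mass d phi N Y e s)).
Proof.
exact/cvg_lim/ereal_nondecreasing_cvgn/nondecreasing_min_mass.
Qed.

(** Since every n_i >= N, each term satisfies n_i^(-t) = n_i^(-(t-s)) n_i^(-s) <= N^(-(t-s))
    n_i^(-s). *)
Lemma min_mass_shift Y e N s t : (0 < N)%N -> s <= t ->
  (min_mass d phi N Y e t <=
   (N%:R `^ (- (t - s)))%:E * min_mass d phi N Y e s)%E.
Proof.
move=> N0 st; set c := (_ `^ _).
have c0 : 0 < c by rewrite powR_gt0// ltr0n.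
rewrite -lee_pdivrMl//; apply: le_ereal_inf_tmp => _ [I [n [x [[Nn xY] ->]]]].
rewrite lee_pdivrMl//.
apply: (@le_trans _ _ (family_mass n t)).
  by apply: ereal_inf_lbound; exists I, n, x.
(* [esum] is a supremum over finite index sets, so it suffices to bound finite sums. *)
apply: ge_ereal_sup => _ [A fA <-].
apply: (@le_trans _ _ (c%:E * \sum_(i \in A) ((n i)%:R `^ (- s))%:E)%E).
  rewrite ge0_mule_fsumr; last by move=> i; rewrite lee_fin powR_ge0.
  apply: lee_fsum; first by case: fA.
  move=> i _; rewrite -EFinM lee_fin.
  have n0 : (0 < n i)%N by exact: leq_trans (Nn i).
  have -> : - t = - (t - s) + (- s) by rewrite opprB addrAC subrr add0r.
  rewrite powRD; last by rewrite pnatr_eq0 -lt0n n0 implybT.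
  rewrite ler_wpM2r ?powR_ge0// /c !powRN lef_pV2 ?posrE ?powR_gt0 ?ltr0n//.
  by rewrite ge0_ler_powR ?nnegrE ?subr_ge0 ?ler0n// ler_nat.
by rewrite lee_pmul2l// esum_ge//; exists A.
Qed.

Lemma powR_natN_small (r c : R) : 0 < r -> 0 < c ->
  exists2 N, (0 < N)%N & forall n, (N <= n)%N -> n%:R `^ (- r) <= c.
Proof.
(* The threshold [a] solves a^(-r) = c. *)
move=> r0 c0; set a := c^-1 `^ r^-1.
have a0 : 0 <= a by exact: powR_ge0.
exists (Num.bound a).
  by rewrite -(ltr0n R); exact: le_lt_trans a0 (archi_boundP a0).
move=> n an; have {}an : a <= n%:R.
  by apply: le_trans (ltW (archi_boundP a0)) _; rewrite ler_nat.
rewrite powRN -[c]invrK lef_pV2 ?posrE ?invr_gt0//; last first.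
  by rewrite powR_gt0// (lt_le_trans _ an)// powR_gt0// invr_gt0.
have -> : c^-1 = a `^ r.
  by rewrite /a -powRrM mulVf ?gt_eqF// powRr1// invr_ge0 ltW.
by rewrite ge0_ler_powR ?nnegrE// ltW.
Qed.

(** As for Hausdorff measures: a finite value at s bounds all minimal masses by one constant, and
    raising the exponent to t gains a factor N^(-(t-s)) that tends to 0. *)
Lemma weak_Delta_eq0 Y e s t : s < t ->
  (weak_Delta d phi Y e s < +oo)%E -> weak_Delta d phi Y e t = 0%E.
Proof.
move=> st; rewrite !weak_DeltaE => fins.
have [K K0 sK] : exists2 K : R, 0 < K &
    forall N, (min_mass d phi N Y e s <= K%:E)%E.
  move: fins; set S := ereal_sup _ => fins.
  have leS N : (min_mass d phi N Y e s <= S)%E.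
    by apply: ereal_sup_ubound; exists N.
  have S0 : (0 <= S)%E by exact: le_trans (min_mass_ge0 _ _ _ _) (leS 0%N).
  have Sf : S \is a fin_num by rewrite ge0_fin_numE.
  (* Adding 1 keeps the bound positive even if the supremum is 0, so that c can be divided by it. *)
  exists (fine S + 1); first by rewrite ltr_wpDl// fine_ge0.
  move=> N; apply: le_trans (leS N) _.
  by rewrite -[leLHS]fineK// lee_fin lerDl.
apply/eqP; rewrite eq_le; apply/andP; split; last first.
  apply: le_trans (min_mass_ge0 0%N Y e t) _.
  by apply: ereal_sup_ubound; exists 0%N.
apply: ge_ereal_sup => _ [N _ <-]; apply/lee_addgt0Pr => c c0; rewrite add0e.
have [|M M0 Msmall] := @powR_natN_small (t - s) (c / K) _ (divr_gt0 c0 K0).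
  by rewrite subr_gt0.
(* By monotonicity in [N], the time bound may be raised past the threshold [M]. *)
have Nm : (N <= maxn N M)%N := leq_maxl N M.
apply: le_trans (nondecreasing_min_mass Y e t Nm) _.
apply: le_trans (min_mass_shift Y e _ (ltW st)) _.
  by rewrite (leq_trans M0)// leq_maxr.
apply: (@le_trans _ _ ((c / K)%:E * K%:E)%E).
  apply: lee_pmul; rewrite ?lee_fin ?powR_ge0 ?min_mass_ge0//.
  by apply: Msmall; rewrite leq_maxr.
by rewrite -EFinM lee_fin divfK// gt_eqF.
Qed.

(** The infimum of the exponents s >= 0 where [weak_Delta] vanishes is critical (+oo if there are
    none). A finite value at some s below it would, by [weak_Delta_eq0], put every s + c with c > 0
    among these exponents and force the infimum down to s. *)
Lemma critical_exponentP Y e :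
  is_critical_exponent d phi Y e (critical_exponent d phi Y e).
Proof.
rewrite /critical_exponent; apply: xgetPex.
pose S := [set s%:E | s in
  [set s : R | 0 <= s /\ weak_Delta d phi Y e s = 0%E]].
exists (ereal_inf S); split.
  by apply: le_ereal_inf_tmp => _ [s [s0 _] <-]; rewrite lee_fin.
move=> s s0; split.
  move=> /ereal_inf_lt[_ [t [t0 Dt] <-]]; rewrite lte_fin => ts.
  by apply: weak_Delta_eq0 ts _; rewrite Dt ltry.
move=> sS; apply/eqP; rewrite -leye_eq leNgt; apply/negP => fins.
move: sS; apply/negP; rewrite -leNgt; apply/lee_addgt0Pr => c c0.
apply: ereal_inf_lbound; exists (s + c) => //=; split.
  by rewrite addr_ge0// ltW.
by apply: weak_Delta_eq0 fins; rewrite ltrDl.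
Qed.

End weak.

(** Otherwise, at a real s strictly between the two exponents, the left [weak_Delta] would be +oo
    and the right one 0. *)
Lemma critical_exponent_le (R : realType) (X X' : Type) (d : X -> X -> R)
    (phi : X -> X) (d' : X' -> X' -> R) (psi : X' -> X') Y Y' r e :
  (forall s, weak_Delta d' psi Y' e s <= weak_Delta d phi Y r s)%E ->
  (critical_exponent d' psi Y' e <= critical_exponent d phi Y r)%E.
Proof.
move=> D'D; have := critical_exponentP d phi Y r.
have := critical_exponentP d' psi Y' e.
set sc' := critical_exponent d' _ _ _; set sc := critical_exponent d _ _ _.
move=> [sc'0 H'] [sc0 H]; rewrite leNgt; apply/negP => ltsc.
have [s [s0 scs ssc']] : exists s : R,
    [/\ 0 <= s, (sc < s%:E)%E & (s%:E < sc')%E].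
  have scf : sc \is a fin_num.
    by rewrite ge0_fin_numE// (lt_le_trans ltsc)// leey.
  move: ltsc sc0; rewrite -(fineK scf) lee_fin; move: (fine sc) => a.
  case: (sc') => [b||] ab a0 //; last first.
    by exists (a + 1); rewrite lte_fin ltrDl ltr01 ltry; split=> //;
      rewrite addr_ge0.
  rewrite lte_fin in ab; exists ((a + b) / 2).
  rewrite !lte_fin !midf_lt// divr_ge0// addr_ge0// ltW//.
  exact: le_lt_trans ab.
have := D'D s; rewrite (H s s0).1// (H' s s0).2//.
Qed.

(** * Comparison of the indices of two systems *)

Definition index_at (k : index_kind) (R : realType) (X : Type)
    (d : X -> X -> R) (phi : X -> X) (Y : set X) (e : R) : \bar R :=
  match k with
  | Upper => upper_index_at d phi Y e
  | Weak => critical_exponent d phi Y e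
  | Lower => lower_index_at d phi Y e
  end.

(** Scaled cover numbers of [Y'] lie between 0 and those of [Y]. Hence decay to 0 passes from [Y] to
    [Y'], enlarging the set of the infimum, and divergence passes from [Y'] to [Y], enlarging that
    of the supremum. *)
Lemma index_at_transfer k (R : realType) (X X' : Type) (d : X -> X -> R)
    (phi : X -> X) (d' : X' -> X' -> R) (psi : X' -> X') Y Y' r e :
  cover_transfer d phi d' psi Y Y' r e ->
  (index_at k d' psi Y' e <= index_at k d phi Y r)%E.
Proof.
move=> H.
have scaled s n : (0 <= scaled_cover_number d' psi Y' e s n
                     <= scaled_cover_number d phi Y r s n)%E.
  have n0 : (0 <= (n%:R `^ (- s))%:E :> \bar R)%E by rewrite lee_fin powR_ge0.
  apply/andP; split; last first.
    by apply: lee_wpmul2l => //; exact: cover_number_transfer.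
  by apply: mule_ge0 => //; apply: le_ereal_inf_tmp => _ [m _ <-];
    rewrite lee_fin.
case: k => /=.
- apply: ereal_inf_le_tmp => _ [s [s0 sc] <-]; exists s => //; split=> //.
  by apply: squeeze_cvge (cvg_cst _) sc; exact: nearW.
- apply: critical_exponent_le => s; rewrite !weak_DeltaE.
  apply: ge_ereal_sup => _ [N _ <-].
  apply: le_trans (min_mass_transfer N s H) _.
  by apply: ereal_sup_ubound; exists N.
- rewrite /lower_index_at ge_max le_max lexx/= le_max.
  apply/orP; right; apply: ereal_sup_le => _ [s [s0 sc] <-].
  exists s => //; split=> //.
  by apply: gee_cvgy sc; apply: nearW => n; case/andP: (scaled s n).
Qed.

(** Balls grow with the radius, so transfer along the identity relation makes the index
    nonincreasing in e, and its right limit at 0 is a supremum. *)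
Lemma CplusE k (R : realType) (X : Type) (d : X -> X -> R) (phi : X -> X) Y :
  Cplus k d phi Y =
  ereal_sup [set index_at k d phi Y e | e in [set e : R | 0 < e]].
Proof.
have -> : Cplus k d phi Y = lim (index_at k d phi Y e @[e --> 0^'+]) by case: k.
rewrite -set_itvoy.
apply/cvg_lim => //; apply: nonincreasing_at_right_cvge => // e r.
rewrite !in_itv/= !andbT => e0 r0 er; apply: index_at_transfer.
exists set1; first by move=> y Yy; exists y.
move=> _ n x; exists x => y /(dyn_ballP _ _ _ _ _ e0) xy _ ->.
by apply/dyn_ballP => // k' /xy ?; exact: lt_le_trans er.
Qed.

Lemma Cplus_le k (R : realType) (X X' : Type) (d : X -> X -> R)
    (phi : X -> X) (d' : X' -> X' -> R) (psi : X' -> X') Y Y' :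
  (forall e, 0 < e ->
    exists2 r, 0 < r & cover_transfer d phi d' psi Y Y' r e) ->
  (Cplus k d' psi Y' <= Cplus k d phi Y)%E.
Proof.
move=> H; rewrite !CplusE; apply: ge_ereal_sup => _ [e /= e0 <-].
have [r r0 re] := H e e0; apply: le_trans (index_at_transfer k re) _.
by apply: ereal_sup_ubound; exists r.
Qed.

Definition metric_unif_continuous (R : realType) (X X' : Type)
    (d : X -> X -> R) (d' : X' -> X' -> R) (h : X -> X') : Prop :=
  forall e, 0 < e -> exists2 r, 0 < r &
    forall x y, d x y < r -> d' (h x) (h y) < e.

(** As h commutes with iterates, one modulus r of uniform continuity serves all times n. Asking only
    for an inclusion in h(Y) lets h = id give monotonicity. *)
Lemma Cplus_semiconj k (R : realType) (X X' : Type) (d : X -> X -> R)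
    (phi : X -> X) (d' : X' -> X' -> R) (psi : X' -> X') (h : X -> X')
    (Y : set X) (Y' : set X') :
  metric_unif_continuous d d' h -> psi \o h =1 h \o phi -> Y' `<=` h @` Y ->
  (Cplus k d' psi Y' <= Cplus k d phi Y)%E.
Proof.
move=> hu hc Y'Y; apply: Cplus_le => e e0; have [r r0 hr] := hu e e0.
have it j x : iter j psi (h x) = h (iter j phi x).
  by elim: j => //= j ->; exact: hc.
exists r => //; exists (fun y => [set h y]).
  by move=> y' /Y'Y[y Yy <-]; exists y.
move=> _ n x; exists (h x) => y /(dyn_ballP _ _ _ _ _ r0) xy _ ->.
by apply/dyn_ballP => // j jn; rewrite !it; exact/hr/xy.
Qed.

(** * Metric topology and uniform continuity *)

Lemma metric_open_ball (R : realType) (X : Type) (d : X -> X -> R) x r :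
  is_metric d -> metric_open d [set y | d x y < r].
Proof.
move=> md y /= xy; exists (r - d x y); first by rewrite subr_gt0.
by move=> z /=; rewrite ltrBrDl; exact/le_lt_trans/is_metric_triangle.
Qed.

Definition metric_continuous (R : realType) (X X' : Type)
    (d : X -> X -> R) (d' : X' -> X' -> R) (h : X -> X') : Prop :=
  forall x e, 0 < e -> exists2 r, 0 < r &
    forall y, d x y < r -> d' (h x) (h y) < e.

(* Phrased through metric_open alone, hence the same for topologically
   equivalent metrics. *)
Definition metric_compact (R : realType) (X : choiceType)
    (d : X -> X -> R) : Prop :=
  forall U : X -> set X, (forall x, metric_open d (U x)) -> (forall x, U x x) ->
  exists s : seq X, forall y, exists2 x, x \in s & U x y.

Lemma heine_cantor (R : realType) (X : choiceType) (X' : Type)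
    (d : X -> X -> R) (d' : X' -> X' -> R) (h : X -> X') :
  is_metric d -> is_metric d' -> metric_compact d ->
  metric_continuous d d' h -> metric_unif_continuous d d' h.
Proof.
move=> md md' cd ch e e0.
have e20 : 0 < e / 2 by rewrite divr_gt0.
have /choice[r rP] : forall x, exists r, 0 < r /\
    forall y, d x y < r -> d' (h x) (h y) < e / 2.
  by move=> x; have [r r0 rh] := ch x _ e20; exists r.
have r20 x : 0 < r x / 2 by rewrite divr_gt0//; case: (rP x).
have [||s sP] := cd (fun x => [set y | d x y < r x / 2]).
- by move=> x; exact: metric_open_ball.
- by move=> x /=; rewrite is_metricxx.
(* With [t] below the finitely many half-radii, points closer than [t] lie in a common ball of
   radius r x, whose image is within e / 2 of h x. *)
have [t t0 ts] : exists2 t, 0 < t & forall x, x \in s -> t <= r x / 2.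
  elim: s {sP} => [|x s [t t0 ts]]; first by exists 1.
  exists (Num.min t (r x / 2)); first by rewrite lt_min t0 r20.
  by move=> y; rewrite inE ge_min => /orP[/eqP ->|/ts ->//]; rewrite lexx orbT.
exists t => // y z yz; have [x xs /= xy] := sP y.
have xz : d x z < r x.
  rewrite (le_lt_trans (is_metric_triangle md x y z))// [ltRHS]splitr.
  by rewrite ltrD// (lt_le_trans yz)// ts.
rewrite (le_lt_trans (is_metric_triangle md' _ (h x) _))// [ltRHS]splitr ltrD//.
  rewrite (is_metric_sym md') (rP x).2// (lt_le_trans xy)//.
  by rewrite ler_pdivrMr// ler_peMr ?ler1n// ltW// (rP x).1.
exact: (rP x).2.
Qed.

Lemma mdist_is_metric (R : realType) (X : metricType R) :
  is_metric (@mdist R X).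
Proof.
by split; [exact: mdistxx|exact: mdist_positivity|exact: metric_sym
  |move=> x y z; exact: metric_triangle].
Qed.

Lemma metric_open_mdist (R : realType) (X : metricType R) (A : set X) :
  metric_open (@mdist R X) A <-> open A.
Proof.
rewrite openE; split => H x Ax.
  have [e e0 eA] := H x Ax; apply/nbhs_ballP; exists e => //.
  by rewrite ballEmdist.
have /nbhs_ballP[e e0] := H x Ax; rewrite ballEmdist => eA.
by exists e.
Qed.

Lemma metric_continuous_mdist (R : realType) (X X' : metricType R)
    (h : X -> X') :
  continuous h -> metric_continuous (@mdist R X) (@mdist R X') h.
Proof.
move=> ch x e e0.
have /ch/nbhs_ballP[r r0 rh] : nbhs (h x) (ball (h x) e) by exact: nbhsx_ballx.
exists r => // y xy; have := rh y; rewrite !ballEmdist; exact.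
Qed.

(** If no finite subfamily covers, the complements of finite unions generate a proper filter. A
    cluster point p is then impossible: U p is a neighborhood of p, and its complement is in the
    filter. *)
Lemma metric_compact_mdist (R : realType) (X : metricType R) :
  compact [set: X] -> metric_compact (@mdist R X).
Proof.
move=> cX U oU UU; apply: contrapT => noU.
pose F := filter_from setT
  (fun s : seq X => [set y | forall x, x \in s -> ~ U x y]).
have FF : ProperFilter F.
  apply: filter_from_proper => [|s _].
    apply: filter_fromT_filter => [|s t]; first by exists [::].
    by exists (s ++ t) => y H; split=> x xs; apply: H; rewrite mem_cat xs ?orbT.
  apply: contrapT => /set0P/negP/negPn/eqP s0; apply: noU; exists s => y.
  apply: contrapT => yN; suff : set0 y by [].
  by rewrite -s0 => x xs Uxy; apply: yN; exists x.
have [|p [_ clp]] := cX F _; first exact: filterT.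
have [||y [//]] := clp (~` U p) (U p).
- by exists [:: p] => // y; apply; rewrite mem_head.
- by apply: open_nbhs_nbhs; split; [exact/metric_open_mdist|exact: UU].
Qed.

Lemma unif_continuous_mdist (R : realType) (X X' : metricType R) (h : X -> X') :
  compact [set: X] -> continuous h ->
  metric_unif_continuous (@mdist R X) (@mdist R X') h.
Proof.
move=> /metric_compact_mdist cX /metric_continuous_mdist ch.
by apply: heine_cantor => //; exact: mdist_is_metric.
Qed.

(** Balls for d' are open for d, which is continuity of the identity. *)
Lemma id_unif_continuous (R : realType) (X : choiceType) (d d' : X -> X -> R) :
  is_metric d -> is_metric d' -> metric_compact d ->
  topologically_equivalent d d' -> metric_unif_continuous d d' id.
Proof.
move=> md md' cd dd'; apply: heine_cantor => // x e e0.
have [|r r0 rx] := (dd' [set y | d' x y < e]).2 (metric_open_ball md') x.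
  by rewrite /= is_metricxx.
by exists r.
Qed.

(** * Change of metric, restriction, conjugacy and the final assembly *)

Lemma Cplus_metric k (R : realType) (X : choiceType) (d d' : X -> X -> R)
    phi Y :
  is_metric d -> is_metric d' -> metric_compact d ->
  topologically_equivalent d d' -> Cplus k d phi Y = Cplus k d' phi Y.
Proof.
move=> md md' cd dd'.
have d'd : topologically_equivalent d' d by move=> A; rewrite dd'.
have cd' : metric_compact d' by move=> U oU; apply: cd => x; exact/dd'.
by apply/eqP; rewrite eq_le; apply/andP; split;
  apply: (@Cplus_semiconj _ _ _ _ _ _ _ _ id); rewrite ?image_id//;
  exact: id_unif_continuous.
Qed.

Lemma Cplus_restr k (R : realType) (X : Type) (d : X -> X -> R) (phi : X -> X)
    (Y : set X) (invY : phi @` Y `<=` Y) : is_metric d ->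
  Cplus k d phi Y = Cplus k (induced_dist d (Y := Y)) (restr_map invY) [set: Y].
Proof.
move=> md; apply/eqP; rewrite eq_le; apply/andP; split.
  apply: (@Cplus_semiconj _ _ _ _ _ _ _ _ (@set_val _ Y)) => //.
    by move=> e e0; exists e.
  by move=> y Yy; exists (SigSub (mem_set Yy)).
have it j (y : Y) :
    set_val (iter j (restr_map invY) y) = iter j phi (set_val y).
  by elim: j => //= j <-.
apply: Cplus_le => e e0; have e20 : 0 < e / 2 by rewrite divr_gt0.
(* The inverse of the inclusion of [Y], as a relation that is empty off [Y]. *)
exists (e / 2) => //; exists (fun y => [set z : Y | set_val z = y]).
  by move=> y _; exists (set_val y) => //; exact: set_valP.
move=> [y0 _] n x.
(* Recentering at a point of Y is what costs the factor 2 in the radius. *)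
have [[z xz]|xN] :=
  pselect (exists z : Y, dyn_ball d phi n x (e / 2) (set_val z)).
  exists z => v xv y /= yv; subst v; apply/dyn_ballP => // j jn.
  move: xz xv => /(dyn_ballP _ _ _ _ _ e20)/(_ _ jn) xz.
  move=> /(dyn_ballP _ _ _ _ _ e20)/(_ _ jn) xy.
  rewrite /induced_dist !it.
  rewrite (le_lt_trans (is_metric_triangle md _ (iter j phi x) _))//.
  by rewrite [ltRHS]splitr ltrD// (is_metric_sym md).
(* A ball that misses [Y] has nothing to transfer, so any center will do. *)
by exists y0 => v xv y yE; case: xN; exists y; rewrite yE.
Qed.

Lemma Cplus_conj k (R : realType) (X X' : metricType R) (phi : X -> X)
    (psi : X' -> X') (h : X -> X') (Y : set X) :
  compact [set: X] -> compact [set: X'] -> homeomorphism h ->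
  psi \o h = h \o phi -> Cplus k mdist phi Y = Cplus k mdist psi (h @` Y).
Proof.
move=> cX cX' [ch [g [cg hK gK]]] hc; apply/eqP; rewrite eq_le.
apply/andP; split; last first.
  apply: (@Cplus_semiconj _ _ _ _ _ _ _ _ h) => //.
    exact: unif_continuous_mdist.
  by move=> x; rewrite hc.
apply: (@Cplus_semiconj _ _ _ _ _ _ _ _ g).
- exact: unif_continuous_mdist.
(* The inverse is a semiconjugacy too: g psi x' = g psi h g x' = g h phi g x' = phi g x'. *)
- by move=> x' /=; rewrite -{2}[x']gK -[psi _]/((psi \o h) _) hc /= hK.
- by move=> y Yy; exists (h y); [exists y|exact: hK].
Qed.

Theorem proposition2p1 (k : index_kind) (R : realType) (X : metricType R)
    (phi : X -> X) (cptX : compact [set: X]) (cphi : continuous phi) :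
  (* (1) invariance *)
  ((forall (X' : metricType R) (psi : X' -> X') (h : X -> X'),
      compact [set: X'] -> continuous psi ->
      homeomorphism h -> psi \o h = h \o phi ->
      Cplus k mdist phi [set: X] = Cplus k mdist psi [set: X'] /\
      (forall Y : set X, Cplus k mdist phi Y = Cplus k mdist psi (h @` Y)))
   /\
   (forall d' : X -> X -> R,
      is_metric d' -> topologically_equivalent mdist d' ->
      forall Y : set X, Cplus k mdist phi Y = Cplus k d' phi Y))
  /\
  (* (2) factors *)
  (forall (X' : metricType R) (psi : X' -> X') (h : X -> X'),
      compact [set: X'] -> continuous psi ->
      continuous h -> h @` [set: X] = [set: X'] -> psi \o h = h \o phi ->
      (Cplus k mdist psi [set: X'] <= Cplus k mdist phi [set: X])%E)
  /\
  (* (3) restriction *)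
  (forall (Y : set X) (invY : phi @` Y `<=` Y),
      Cplus k mdist phi Y
      = Cplus k (induced_dist mdist (Y := Y)) (restr_map invY) [set: Y])
  /\
  (* (4) monotonicity *)
  (forall Y Y' : set X, Y `<=` Y' ->
      (Cplus k mdist phi Y <= Cplus k mdist phi Y')%E)
  /\
  (* (5) transport *)
  ((forall Y : set X,
      (Cplus k mdist phi (phi @` Y) <= Cplus k mdist phi Y)%E)
   /\
   (homeomorphism phi ->
      forall Y : set X, Cplus k mdist phi (phi @` Y) = Cplus k mdist phi Y)).
Proof.
split; [split|split; [|split; [|split; [|split]]]].
- move=> X' psi h cX' _ hh hc; split=> [|Y]; last exact: Cplus_conj.
  rewrite (Cplus_conj k [set: X] cptX cX' hh hc); congr (Cplus _ _ _ _).
  have [_ [g [_ _ gK]]] := hh.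
  by apply/seteqP; split => // x' _; exists (g x').
- move=> d' md' dd' Y; apply: Cplus_metric => //.
    exact: mdist_is_metric.
  exact: metric_compact_mdist.
- move=> X' psi h _ _ ch hX hc.
  apply: (@Cplus_semiconj _ _ _ _ _ _ _ _ h) => [|x|].
  + exact: unif_continuous_mdist.
  + by rewrite hc.
  + by rewrite hX.
- by move=> Y invY; exact/Cplus_restr/mdist_is_metric.
- move=> Y Y' YY'; apply: (@Cplus_semiconj _ _ _ _ _ _ _ _ id) => //.
    by move=> e e0; exists e.
  by rewrite image_id.
- move=> Y; apply: (@Cplus_semiconj _ _ _ _ _ _ _ _ phi) => //.
  exact: unif_continuous_mdist.
(* A homeomorphism [phi] conjugates itself to itself. *)
- by move=> hphi Y; apply/esym/Cplus_conj.
Qed.
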